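(* Let $n\ge 1$, let $U=[u_{k,l}]$ be an $n\times n$ matrix of non-negative integers and let $v_1,\ldots,v_n$ be non-negative integers. Then $$H_{n}(t,q;\, U;\, v_{1},\ldots,v_{n}) = \sum_{i=1}^{n} q^{i-1}\, t^{e_{i}}\cdot H_{n-1}\bigl(t,q;\; R_{2}'(U,[v_{1},\ldots,v_{n}],i);\; v_{1},\ldots,v_{i-1},\,(v_{i}+v_{i+1}+1),\, v_{i+2},\ldots,v_{n}\bigr),$$ where $e_i=(n-i)u_{i,i}+(n-i-1)u_{i,i+1}+\cdots+(1)u_{i,n-1}$ (so $e_n=0$), and for $i=n$ the list in the last argument is to be read as $v_1,\ldots,v_{n-1}$.
   Context: $\mathcal{S}_n$ is the set of permutations $\pi=\pi_1\ldots\pi_n$ of $\{1,\ldots,n\}$. $\mathrm{inv}(\pi)$ is the number of pairs $1\le a<b\le n$ with $\pi_a>\pi_b$. $N_{1324}(\pi)$ is the number of occurrences of the pattern $1324$ in $\pi$, i.e. the number of index quadruples $1\le a<b<c<d\le n$ with $\pi_a<\pi_c<\pi_b<\pi_d$. Let $t$, $q$, $x_{i,j}$ ($1\le i\le j\le n$) and $y_{i,j}$ ($1\le j\le i\le n$) be commuting variables. The weight of $\pi\in\mathcal{S}_n$ is $$\mathrm{weight}(\pi) := t^{N_{1324}(\pi)} \prod_{1\le i\le j\le n} x_{i,j}^{\#\{(a,b)\,:\, \pi_a<\pi_b,\ \pi_a=i,\ \pi_b>j\}} \cdot \prod_{1\le j\le i\le n} y_{i,j}^{\#\{(a,b,c)\,:\,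 \pi_b<\pi_a<\pi_c,\ \pi_a=i,\ \pi_b\ge j\}},$$ where always $1\le a<b<c\le n$ (respectively $1\le a<b\le n$ for pairs). Let $$P_n(t,q;X_n,Y_n):=\sum_{\pi\in\mathcal{S}_n}q^{\mathrm{inv}(\pi)}\,\mathrm{weight}(\pi),$$ with $X_n=[x_{i,j}]$, $Y_n=[y_{i,j}]$; for $n\times n$ matrices $A,B$, $P_n(t,q;A,B)$ denotes the result of substituting $x_{i,j}=A_{i,j}$ for $i\le j$ and $y_{i,j}=B_{i,j}$ for $j\le i$ (entries of $A$ below the diagonal and of $B$ above the diagonal are disregarded). By convention $P_0=1$. For an $n\times n$ matrix $U=[u_{i,j}]$ of non-negative integers and non-negative integers $v_1,\ldots,v_n$, $$H_n(t,q;\,U;\,v_1,\ldots,v_n):=P_n(t,q;\,C,D),$$ where $C$ and $D$ are the $n\times n$ matrices with $c_{i,j}=t^{u_{i,j}}$ for all $1\le i,j\le n$ and with every row of $D$ equal to $[t^{v_1},\ldots,t^{v_n}]$. Operator $R_2'$: for an $n\times n$ matrix $U=[u_{k,l}]$ of non-negative integers, a vector $[v_1,\ldots,v_n]$ of non-negative integers and $1<i\le n$, $R_2'(U,[v_1,\ldots,v_n],i)$ is the $(n-1)\times(n-1)$ matrix obtained from $U$ by deleting the $i$-th row and replacing the $(i-1)$-th and $i$-th columns by a single column, whose entry in the row coming from row $k$ ($k\ne i$) is $$w_k':=\begin{cases} (v_1+v_2+\cdots+v_k)+u_{k,i-1}+u_{k,i} & k\le i-1,\\ 0 & k>i-1.\end{cases}$$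 If $i=1$, $R_2'(U,[v_1,\ldots,v_n],1)$ is obtained from $U$ by deleting the first row and first column. *)

(* Defs.v *)
From mathcomp Require Import all_boot all_order all_fingroup all_algebra.

Set Implicit Arguments.
Unset Strict Implicit.
Unset Printing Implicit Defensive.

Import GRing.Theory.

(* Positions, values and matrix indices 1, ..., n are shifted
   to 0, ..., n-1, i.e. to 'I_n; only comparisons between them matter in the
   counts below. *)

Section Counts.

Local Open Scope nat_scope.

Variables (n : nat) (pi : 'S_n).

Definition inversions : nat :=
  #|[set x : 'I_n * 'I_n | let: (a, b) := x in (a < b) && (pi b < pi a)]|.

Definition N1324 : nat :=
  #|[set x : 'I_n * 'I_n * 'I_n * 'I_n | let: (a, b, c, d) := x in
      [&& a < b, b < c, c < d, pi a < pi c, pi c < pi b & pi b < pi d]]|.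

Definition xexp (i j : 'I_n) : nat :=
  #|[set x : 'I_n * 'I_n | let: (a, b) := x in
      [&& a < b, pi a < pi b, pi a == i & j < pi b]]|.

Definition yexp (i j : 'I_n) : nat :=
  #|[set x : 'I_n * 'I_n * 'I_n | let: (a, b, c) := x in
      [&& a < b, b < c, pi b < pi a, pi a < pi c, pi a == i & j <= pi b]]|.

End Counts.

Local Open Scope ring_scope.

(* The commuting variables t, q, x_(i,j), y_(i,j) are represented by arbitrary
   elements of an arbitrary commutative ring: polynomial identities are
   recovered by taking the ring to be a polynomial ring and the elements to be
   its variables, and substitution is application to other elements.  The
   entries of X below the diagonal and of Y above the diagonal are ignored. *)
Definition weight (R : comNzRingType) (n : nat) (t : R) (X Y : 'M[R]_n)
    (pi : 'S_n) : R :=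
  t ^+ N1324 pi
  * (\prod_(i < n) \prod_(j < n | (i <= j)%N) X i j ^+ xexp pi i j)
  * (\prod_(i < n) \prod_(j < n | (j <= i)%N) Y i j ^+ yexp pi i j).

Definition Pn (R : comNzRingType) (n : nat) (t q : R) (X Y : 'M[R]_n) : R :=
  \sum_(pi : 'S_n) q ^+ inversions pi * weight t X Y pi.

Definition Hn (R : comNzRingType) (n : nat) (t q : R) (U : 'M[nat]_n)
    (v : 'rV[nat]_n) : R :=
  Pn t q (\matrix_(i, j) t ^+ U i j) (\matrix_(i, j) t ^+ v 0 j).

(* Row k of the result comes from row [lift i k] of U.  With 0-based indices the
   columns i-1 and i of U are merged into column i-1 of the result, and column
   l <> i-1 of the result comes from column [lift i l] of U.  In the merged
   column, where l + 1 = i, [lift i l] is column i-1 of U.  For i = 0 no l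
   satisfies l + 1 = i, so row 0 and column 0 are just deleted. *)
Definition R2' (n : nat) (U : 'M[nat]_n.+1) (v : 'rV[nat]_n.+1) (i : 'I_n.+1) :
    'M[nat]_n :=
  \matrix_(k, l)
    let k' := lift i k in let l' := lift i l in
    if l.+1 == i :> nat then
      if (k' < i)%N
      then ((\sum_(m < n.+1 | m <= k') v 0%R m) + U k' l' + U k' i)%N
      else 0%N
    else U k' l'.

(* The list v_1, ..., v_(i-1), v_i + v_(i+1) + 1, v_(i+2), ..., v_n.  At l = i,
   [lift i l] is the index following i; if i is the last index, no l equals i
   and the last entry is just dropped. *)
Definition merge_v (n : nat) (v : 'rV[nat]_n.+1) (i : 'I_n.+1) : 'rV[nat]_n :=
  \row_l if l == i :> nat then (v 0%R i + v 0%R (lift i l) + 1)%N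
         else v 0%R (lift i l).

(* In 1-based indices and for dimension n+1, the sum over i <= j <= n+1 of
   (n + 1 - j) u_(i,j), whose last term is 0. *)
Definition e_exp (n : nat) (U : 'M[nat]_n.+1) (i : 'I_n.+1) : nat :=
  (\sum_(j < n.+1 | i <= j) (n - j) * U i j)%N.

(* Main.v *)
Require Import Defs.
From mathcomp Require Import all_boot all_order all_fingroup all_algebra.
From mathcomp Require Import zify.

Set Implicit Arguments.
Unset Strict Implicit.
Unset Printing Implicit Defensive.

(** After the substitution, every permutation [pi] contributes
    [q ^ inv pi * t ^ E pi] to [Hn], and the identity says how the pair
    [(inv, E)] changes when the first letter of [pi] is removed.

    The exponent [E] becomes tractable once it is written as a sum over pattern
    occurrences ([HnE]).  Counting the contribution of each occurrence instead
    of the occurrences for each variable gives three terms: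
    - 1 for each occurrence of 1324;
    - [u_(k,k) + ... + u_(k,m-1)] for each occurrence of 12 by letters [k < m];
    - [v_1 + ... + v_k] for each occurrence of 213 whose smallest letter is [k].

    A permutation with first letter [i] is [lift_perm ord0 i s] for a unique
    [s] of one letter less.  Its occurrences that avoid position 0 are those of
    [s], with letters relabelled by [lift i]; those that use position 0 are
    occurrences in [s] of the pattern without its first letter, restricted by
    comparison with [i].  Thus 1324 produces 213 with all letters above [i]
    ([N1324_lift]), 213 produces 12 with letters on both sides of [i]
    ([sum213_lift]), and 12 produces single letters above [i] ([sum12_lift]),
    whose total weight is the constant [e_i] ([sum_rowsum]).

    The operators [R2'] and [merge_v] absorb exactly these extra terms: the
    first adds [v_1 + ... + v_k] to the weight of the pairs that straddle [i]
    ([rowsum_R2']), the second adds 1 to the weight of the 213 above [i]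
    ([prefix_sum_merge_v]).  Hence the exponent of [lift_perm ord0 i s] is [e_i]
    plus the exponent of [s] for the new parameters, and [i] more inversions
    come from the first letter. *)

Local Open Scope ring_scope.

(** * Relabelling letters by [lift] *)

Lemma ltn_lift2 n (h : 'I_n.+1) (i j : 'I_n) :
  (lift h i < lift h j)%N = (i < j)%N.
Proof. by rewrite /= !ltnNge leq_bump2. Qed.

Lemma leq_lift2 n (h : 'I_n.+1) (i j : 'I_n) :
  (lift h i <= lift h j)%N = (i <= j)%N.
Proof. exact: leq_bump2. Qed.

Lemma lift_ltn n (h : 'I_n.+1) (i : 'I_n) : (lift h i < h)%N = (i < h)%N.
Proof. by rewrite /= /bump; case: leqP; lia. Qed.

Lemma ltn_lift n (h : 'I_n.+1) (i : 'I_n) : (h < lift h i)%N = (h <= i)%N.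
Proof. by rewrite /= /bump; case: leqP; lia. Qed.

Lemma leq_lift n (h : 'I_n.+1) (i : 'I_n) : (h <= lift h i)%N = (h <= i)%N.
Proof. by rewrite -ltn_lift ltn_neqAle neq_lift. Qed.

Lemma lift_leq n (h : 'I_n.+1) (i : 'I_n) : (lift h i <= h)%N = (i < h)%N.
Proof. by rewrite leqNgt ltn_lift ltnNge. Qed.

(** * Removing the first letter of a permutation *)

(** A permutation is determined by its first letter [i] and the standardization
    [s] of the remaining letters, because [lift i] maps the letters of [s]
    bijectively onto the letters other than [i]. *)
Lemma sum_perm_lift (R : nmodType) n (F : 'S_n.+1 -> R) :
  \sum_(pi : 'S_n.+1) F pi = \sum_i \sum_(s : 'S_n) F (lift_perm ord0 i s).
Proof.
rewrite (partition_big (fun pi : 'S_n.+1 => pi ord0) predT) //=.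
apply: eq_bigr => i _.
have lift_inj_at : injective (lift_perm (n := n) ord0 i).
  move=> s1 s2 /permP eq_s; apply/permP => k; apply: (@lift_inj _ i).
  by have := eq_s (lift ord0 k); rewrite !lift_perm_lift.
rewrite -(big_imset (h := lift_perm ord0 i) (A := predT) F) /=; last first.
  by move=> s1 s2 _ _ /lift_inj_at.
apply: eq_bigl => pi; apply/eqP/imsetP => [pi0 | [s _ ->]]; last first.
  by rewrite lift_perm_id.
pose s k := odflt k (unlift i (pi (lift ord0 k))).
have sK k : lift i (s k) = pi (lift ord0 k).
  rewrite /s; case: unliftP => [j -> // | /eqP].
  by rewrite -pi0 (inj_eq perm_inj) lift_eqF.
have s_inj : injective s.
  move=> k1 k2 /(congr1 (lift i)); rewrite !sK => /perm_inj; exact: lift_inj.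
exists (perm s_inj) => //; apply/permP => k.
case: (unliftP ord0 k) => [k' | ] ->; last by rewrite lift_perm_id.
by rewrite lift_perm_lift permE sK.
Qed.

Local Open Scope nat_scope.

(** * Sums over pattern occurrences *)

Definition sum12 n (f : 'I_n -> 'I_n -> nat) (pi : 'S_n) : nat :=
  \sum_(a < n) \sum_(b < n) ((a < b) && (pi a < pi b)) * f (pi a) (pi b).

Definition sum213 n (g : 'I_n -> nat) (pi : 'S_n) : nat :=
  \sum_(a < n) \sum_(b < n) \sum_(c < n)
    [&& a < b, b < c, pi b < pi a & pi a < pi c] * g (pi b).

Lemma card_set_sum (T : finType) (P : pred T) : #|[set x | P x]| = \sum_x P x.
Proof.
by rewrite -sum1dep_card big_mkcond /=; apply: eq_bigr => x _; case: P.
Qed.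

Lemma inversionsE n (pi : 'S_n) :
  inversions pi = \sum_(a < n) \sum_(b < n) ((a < b) && (pi b < pi a)).
Proof.
by rewrite /inversions card_set_sum pair_bigA; apply: eq_bigr => -[].
Qed.

Lemma N1324E n (pi : 'S_n) :
  N1324 pi = \sum_(a < n) \sum_(b < n) \sum_(c < n) \sum_(d < n)
    [&& a < b, b < c, c < d, pi a < pi c, pi c < pi b & pi b < pi d].
Proof.
rewrite /N1324 card_set_sum !pair_bigA /=.
by apply: eq_bigr => -[[[a b] c] d].
Qed.

Lemma xexpE n (pi : 'S_n) i j :
  xexp pi i j =
  \sum_(a < n) \sum_(b < n) [&& a < b, pi a < pi b, pi a == i & j < pi b].
Proof. by rewrite /xexp card_set_sum pair_bigA; apply: eq_bigr => -[]. Qed.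

Lemma yexpE n (pi : 'S_n) i j :
  yexp pi i j = \sum_(a < n) \sum_(b < n) \sum_(c < n)
    [&& a < b, b < c, pi b < pi a, pi a < pi c, pi a == i & j <= pi b].
Proof. by rewrite /yexp card_set_sum !pair_bigA; apply: eq_bigr => -[[]]. Qed.

(** * Occurrences that use the first letter *)

Lemma sum_lift_perm n (i : 'I_n.+1) (s : 'S_n) (F : 'I_n.+1 -> nat) :
  \sum_b F (lift i (s b)) = \sum_(b | b != i) F b.
Proof.
rewrite [LHS](reindex_inj (@perm_inj _ s^-1%g)) /= [RHS]big_mkcond.
rewrite [RHS](bigD1_ord i) //= eqxx add0n.
by apply: eq_bigr => b _; rewrite permKV eq_sym neq_lift.
Qed.

Lemma ltn_ord_sum n (i : 'I_n) : \sum_(b < n) (b < i) = i.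
Proof.
rewrite -[RHS]card_ord -sum1_card.
rewrite (big_ord_widen n (fun=> 1)) ?(ltnW (ltn_ord i)) //.
by rewrite [RHS]big_mkcond; apply: eq_bigr => b _; case: ltnP.
Qed.

Lemma sum_ord_recl0 n (F : 'I_n.+1 -> nat) :
  F ord0 = 0 -> \sum_b F b = \sum_(b < n) F (lift ord0 b).
Proof. by move=> F0; rewrite big_ord_recl F0. Qed.

Lemma inversions_lift n (i : 'I_n.+1) (s : 'S_n) :
  inversions (lift_perm ord0 i s) = i + inversions s.
Proof.
rewrite !inversionsE big_ord_recl; congr (_ + _).
  rewrite sum_ord_recl0 //.
  under eq_bigr => b _ do rewrite lift_perm_lift lift_perm_id.
  rewrite (sum_lift_perm i s (fun m => m < i)).
  by rewrite -[RHS]ltn_ord_sum [RHS](bigD1 i) //= ltnn add0n.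
apply: eq_bigr => a _; rewrite sum_ord_recl0 //.
by apply: eq_bigr => b _; rewrite !lift_perm_lift !ltn_lift2.
Qed.

Lemma sum12_lift n f (i : 'I_n.+1) (s : 'S_n) :
  sum12 f (lift_perm ord0 i s) =
  \sum_(m < n.+1 | i < m) f i m + sum12 (fun k m => f (lift i k) (lift i m)) s.
Proof.
rewrite /sum12 big_ord_recl; congr (_ + _).
  rewrite sum_ord_recl0 //.
  under eq_bigr => b _ do rewrite lift_perm_lift lift_perm_id.
  rewrite (sum_lift_perm i s (fun m => (i < m) * f i m)).
  rewrite [LHS]big_mkcond [RHS]big_mkcond; apply: eq_bigr => m _ /=.
  by case: eqVneq => [-> | _]; rewrite ?ltnn // mulnbl.
apply: eq_bigr => a _; rewrite sum_ord_recl0 //.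
by apply: eq_bigr => b _; rewrite !lift_perm_lift !ltn_lift2.
Qed.

(** When the first letter [i] plays the role of 2 in 213, the other two letters
    form a non-inversion that straddles [i]. *)
Lemma sum213_lift n g (i : 'I_n.+1) (s : 'S_n) :
  sum213 g (lift_perm ord0 i s) =
  sum12 (fun k m => (k < i <= m) * g (lift i k)) s
  + sum213 (fun k => g (lift i k)) s.
Proof.
rewrite /sum213 big_ord_recl; congr (_ + _).
  rewrite sum_ord_recl0; last by rewrite big1.
  apply: eq_bigr => b _; rewrite sum_ord_recl0 //.
  apply: eq_bigr => c _.
  rewrite !lift_perm_lift lift_perm_id (ltn_lift i) lift_ltn ltn_lift2.
  by rewrite mulnA mulnb /=; congr (nat_of_bool _ * _); apply/idP/idP; lia.
apply: eq_bigr => a _; rewrite sum_ord_recl0; last by rewrite big1.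
apply: eq_bigr => b _; rewrite sum_ord_recl0 ?andbF //.
by apply: eq_bigr => c _; rewrite !lift_perm_lift !ltn_lift2.
Qed.

(** When the first letter [i] plays the role of 1 in 1324, the other three form
    a 213; all of them exceed [i] as soon as the smallest does. *)
Lemma N1324_lift n (i : 'I_n.+1) (s : 'S_n) :
  N1324 (lift_perm ord0 i s) = sum213 (fun k => i <= k) s + N1324 s.
Proof.
rewrite !N1324E /sum213 big_ord_recl; congr (_ + _).
  rewrite sum_ord_recl0; last by rewrite big1 // => c _; rewrite big1.
  apply: eq_bigr => b _; rewrite sum_ord_recl0; last by rewrite big1.
  apply: eq_bigr => c _; rewrite sum_ord_recl0 ?andbF //.
  apply: eq_bigr => d _.
  rewrite !lift_perm_lift lift_perm_id !ltn_lift2 (ltn_lift i) mulnb /=.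
  by congr nat_of_bool; apply/idP/idP; lia.
apply: eq_bigr => a _; rewrite sum_ord_recl0; last first.
  by rewrite big1 // => c _; rewrite big1.
apply: eq_bigr => b _; rewrite sum_ord_recl0; last first.
  by rewrite big1 // => d _; rewrite andbF.
apply: eq_bigr => c _; rewrite sum_ord_recl0 ?andbF //.
by apply: eq_bigr => d _; rewrite !lift_perm_lift !ltn_lift2.
Qed.

(** * The exponent of [t] *)

(** The weight that the [x]-variables give to a non-inversion with letters
    [k < m]: it is counted in the exponent of [x_(k,j)] for [k <= j < m]. *)
Definition rowsum n (U : 'M[nat]_n) (k m : 'I_n) : nat :=
  \sum_(j < n | k <= j < m) U k j.

(** The weight that the [y]-variables give to an occurrence of 213 with smallest
    letter [m]: it is counted in the exponent of [y_(i,j)], [i] being its first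
    letter, for [j <= m].  The weight is a function of [m] alone because all
    rows of the matrix substituted for the [y]-variables are equal. *)
Definition prefix_sum n (v : 'rV[nat]_n) (m : 'I_n) : nat :=
  \sum_(j < n | j <= m) v 0%R j.

Lemma sum_xexp n (U : 'M[nat]_n) (pi : 'S_n) :
  \sum_(i < n) \sum_(j < n | i <= j) U i j * xexp pi i j = sum12 (rowsum U) pi.
Proof.
under eq_bigr => i _.
  under eq_bigr => j _.
    rewrite xexpE big_distrr /=; under eq_bigr do rewrite big_distrr /=.
    over.
  rewrite exchange_big; under eq_bigr do rewrite exchange_big.
  over.
rewrite exchange_big; apply: eq_bigr => a _.
rewrite exchange_big; apply: eq_bigr => b _.
(* The occurrence at (a, b) is seen only by row i = pi a. *)
rewrite (bigD1 (pi a)) //= [X in _ + X]big1 ?addn0 => [|i ne_i]; last first.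
  rewrite big1 // => j _.
  by rewrite [pi a == i]eq_sym (negPf ne_i) /= !andbF muln0.
rewrite /rowsum big_distrr [LHS]big_mkcond [RHS]big_mkcond.
apply: eq_bigr => j _; rewrite eqxx.
by case: (pi a <= j); case: (a < b); case: (pi a < pi b); case: (j < pi b);
  rewrite /= ?muln0 ?muln1 ?mul0n ?mul1n.
Qed.

Lemma sum_yexp n (v : 'rV[nat]_n) (pi : 'S_n) :
  \sum_(i < n) \sum_(j < n | j <= i) v 0%R j * yexp pi i j =
  sum213 (prefix_sum v) pi.
Proof.
under eq_bigr => i _.
  under eq_bigr => j _.
    rewrite yexpE big_distrr /=.
    under eq_bigr => a _.
      rewrite big_distrr /=.
      under eq_bigr do rewrite big_distrr /=.
      over.
    over.
  rewrite exchange_big.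
  under eq_bigr => a _.
    rewrite exchange_big.
    under eq_bigr do rewrite exchange_big.
    over.
  over.
rewrite exchange_big; apply: eq_bigr => a _.
rewrite exchange_big; apply: eq_bigr => b _.
rewrite exchange_big; apply: eq_bigr => c _.
rewrite (bigD1 (pi a)) //= [X in _ + X]big1 ?addn0 => [|i ne_i]; last first.
  rewrite big1 // => j _.
  by rewrite [pi a == i]eq_sym (negPf ne_i) /= !andbF muln0.
(* The constraint j <= i follows from j <= pi b < pi a = i. *)
rewrite /prefix_sum big_distrr [LHS]big_mkcond [RHS]big_mkcond.
apply: eq_bigr => j _; rewrite eqxx /=.
have [lt_ba | _] := ltnP (pi b) (pi a); last first.
  by rewrite !andbF muln0 mul0n !if_same.
have [le_jb | _] := leqP j (pi b); last by rewrite !andbF muln0 if_same.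
by rewrite (leq_trans le_jb (ltnW lt_ba)) !andbT mulnC.
Qed.

Definition t_exponent n (U : 'M[nat]_n) (v : 'rV[nat]_n) (pi : 'S_n) : nat :=
  N1324 pi + sum12 (rowsum U) pi + sum213 (prefix_sum v) pi.

Lemma HnE (R : comNzRingType) n (t q : R) (U : 'M[nat]_n) v :
  Hn t q U v =
  (\sum_(pi : 'S_n) q ^+ inversions pi * t ^+ t_exponent U v pi)%R.
Proof.
apply: eq_bigr => pi _; congr (_ * _)%R.
rewrite /weight !GRing.exprD -sum_xexp -sum_yexp.
congr (_ * _ * _)%R; rewrite -GRing.prodrXr; apply: eq_bigr => i _;
  by rewrite -GRing.prodrXr; apply: eq_bigr => j _; rewrite mxE GRing.exprM.
Qed.

(** * The effect of [R2'] and [merge_v] on the weights *)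

(** The entry [U i j] occurs once for each of the [n - j] letters [m] above
    [j]. *)
Lemma sum_rowsum n (U : 'M[nat]_n.+1) (i : 'I_n.+1) :
  \sum_(m < n.+1 | i < m) rowsum U i m = e_exp U i.
Proof.
rewrite /rowsum /e_exp (exchange_big_dep (fun j : 'I_n.+1 => i <= j)) /=;
  last first.
  by move=> m j _ /andP[].
apply: eq_bigr => j le_ij.
rewrite (eq_bigl (fun m : 'I_n.+1 => true && (j < m))) => [|m]; last first.
  by rewrite le_ij /= andb_idl // => /(leq_ltn_trans le_ij).
rewrite -(big_geq_mkord _ _ (fun=> true) (fun=> U i j)).
by rewrite sum_nat_const_nat subSS.
Qed.

Lemma sum_eq_nat n (P : pred nat) (k c : nat) :
  \sum_(l < n | P l) (l == k :> nat) * c = ((k < n) && P k) * c.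
Proof.
rewrite big_mkcond /=; have [lt_kn | le_nk] := ltnP k n; last first.
  rewrite big1 // => l _; case: (P l) => //.
  by rewrite ltn_eqF // (leq_trans (ltn_ord l)).
rewrite (bigD1 (Ordinal lt_kn)) //= eqxx mul1n big1 => [|l].
  by rewrite addn0 mulnbl.
by rewrite -val_eqE /= => /negPf->; rewrite if_same.
Qed.

Lemma rowsum_lift n (U : 'M[nat]_n.+1) (i : 'I_n.+1) (k m : 'I_n) :
  rowsum U (lift i k) (lift i m) =
  \sum_(l < n | k <= l < m) U (lift i k) (lift i l)
  + (k < i <= m) * U (lift i k) i.
Proof.
rewrite /rowsum big_mkcond (bigD1_ord i) // lift_leq ltn_lift mulnbl addnC.
congr (_ + _); rewrite [RHS]big_mkcond.
by apply: eq_bigr => l _; rewrite leq_lift2 ltn_lift2.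
Qed.

Lemma prefix_sum_lift n (v : 'rV[nat]_n.+1) (i : 'I_n.+1) (m : 'I_n) :
  prefix_sum v (lift i m) =
  \sum_(l < n | l <= m) v 0%R (lift i l) + (i <= m) * v 0%R i.
Proof.
rewrite /prefix_sum big_mkcond (bigD1_ord i) // leq_lift mulnbl addnC.
congr (_ + _); rewrite [RHS]big_mkcond.
by apply: eq_bigr => l _; rewrite leq_lift2.
Qed.

(** The merged column lies in the range [k <= l < m] exactly when [i - 1] does,
    that is when the letters [k] and [m] straddle [i]; this is also when column
    [i] of [U] lies in the range of [lift i k] and [lift i m]. *)
Lemma rowsum_R2' n (U : 'M[nat]_n.+1) v i (k m : 'I_n) :
  rowsum (R2' U v i) k m =
  rowsum U (lift i k) (lift i m) + (k < i <= m) * prefix_sum v (lift i k).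
Proof.
rewrite rowsum_lift -addnA -mulnDr.
set w := U (lift i k) i + prefix_sum v (lift i k).
(* On this range l + 1 = i forces k < i, so the 0 in the merged column is
   never read. *)
have entry (l : 'I_n) : k <= l < m -> R2' U v i k l =
    U (lift i k) (lift i l) + (l.+1 == i :> nat) * w.
  case/andP=> le_kl _; rewrite mxE; lazy zeta; rewrite lift_ltn /w /prefix_sum.
  case: eqP => [<- | _].
    by rewrite ltnS le_kl; lia.
  by rewrite mul0n addn0.
rewrite /rowsum (eq_bigr _ entry) big_split /=; congr (_ + _).
case: (posnP i) => [-> | i_gt0]; first by rewrite big1.
transitivity (\sum_(l < n | k <= l < m) (l == i.-1 :> nat) * w).
  by apply: eq_bigr => l _; rewrite -[X in _ == X](prednK i_gt0) eqSS.
rewrite (sum_eq_nat _ (fun l => k <= l < m)); congr (nat_of_bool _ * _).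
by have := ltn_ord i; have := ltn_ord m; lia.
Qed.

(** The merged entry, at index [i], stands for [v_i], [v_(i+1)] and the extra 1,
    and it is reached by the sum exactly when [i <= m]. *)
Lemma prefix_sum_merge_v n (v : 'rV[nat]_n.+1) i (m : 'I_n) :
  prefix_sum (merge_v v i) m = prefix_sum v (lift i m) + (i <= m).
Proof.
have entry (l : 'I_n) : l <= m -> merge_v v i 0%R l =
    v 0%R (lift i l) + (l == i :> nat) * (v 0%R i + 1).
  by rewrite mxE; case: eqP => _; lia.
rewrite {1}/prefix_sum (eq_bigr _ entry) big_split /=.
rewrite (sum_eq_nat _ (fun l => l <= m)).
rewrite (andb_idl (fun le_im => leq_ltn_trans le_im (ltn_ord m))).
by rewrite prefix_sum_lift mulnDr muln1 addnA.
Qed.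

(** * The recurrence *)

Lemma sum12D n (f g : 'I_n -> 'I_n -> nat) (pi : 'S_n) :
  sum12 (fun k m => f k m + g k m) pi = sum12 f pi + sum12 g pi.
Proof.
rewrite /sum12 -big_split; apply: eq_bigr => a _ /=.
by rewrite -big_split; apply: eq_bigr => b _; rewrite mulnDr.
Qed.

Lemma sum213D n (f g : 'I_n -> nat) (pi : 'S_n) :
  sum213 (fun k => f k + g k) pi = sum213 f pi + sum213 g pi.
Proof.
rewrite /sum213 -big_split; apply: eq_bigr => a _ /=.
rewrite -big_split; apply: eq_bigr => b _ /=.
by rewrite -big_split; apply: eq_bigr => c _; rewrite mulnDr.
Qed.

Lemma eq_sum12 n (f g : 'I_n -> 'I_n -> nat) (pi : 'S_n) :
  f =2 g -> sum12 f pi = sum12 g pi.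
Proof.
by move=> eq_fg; apply: eq_bigr => a _; apply: eq_bigr => b _; rewrite eq_fg.
Qed.

Lemma eq_sum213 n (f g : 'I_n -> nat) (pi : 'S_n) :
  f =1 g -> sum213 f pi = sum213 g pi.
Proof.
move=> eq_fg; apply: eq_bigr => a _; apply: eq_bigr => b _.
by apply: eq_bigr => c _; rewrite eq_fg.
Qed.

Lemma t_exponent_lift n (U : 'M[nat]_n.+1) v (i : 'I_n.+1) (s : 'S_n) :
  t_exponent U v (lift_perm ord0 i s) =
  e_exp U i + t_exponent (R2' U v i) (merge_v v i) s.
Proof.
rewrite /t_exponent N1324_lift sum12_lift sum213_lift sum_rowsum.
rewrite (eq_sum12 s (rowsum_R2' U v i)) sum12D.
by rewrite (eq_sum213 s (prefix_sum_merge_v v i)) sum213D /=; lia.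
Qed.

Local Open Scope ring_scope.

Theorem corollary3 (R : comNzRingType) (t q : R) (n : nat)
    (U : 'M[nat]_n.+1) (v : 'rV[nat]_n.+1) :
  Hn t q U v =
  \sum_(i < n.+1) q ^+ i * t ^+ e_exp U i * Hn t q (R2' U v i) (merge_v v i).
Proof.
rewrite HnE sum_perm_lift; apply: eq_bigr => i _.
rewrite HnE big_distrr; apply: eq_bigr => s _ /=.
by rewrite inversions_lift t_exponent_lift !GRing.exprD GRing.mulrACA.
Qed.
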